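(* Let $k\ge 0$ be an integer. Suppose there exists an algorithm that, for any unweighted undirected graph with $n$ vertices and $m$ edges, computes a $(2k+1)$-additive spanner with $O(f(n,m))$ edges in $O(g(n,m))$ time. Then there exists an algorithm that, for any unweighted undirected graph with $n$ vertices and $m$ edges, computes a $(2k)$-additive spanner with $O(f(2n,2m))$ edges in $O(g(2n,2m)+m)$ time.
   Context: For an unweighted undirected graph $G=(V,E)$, a $k$-additive spanner is a subgraph $H=(V,E')$ with $E'\subseteq E$ such that $\mathrm{dist}_H(u,v)\le \mathrm{dist}_G(u,v)+k$ for all $u,v\in V$. Here $f$ and $g$ are arbitrary functions of $(n,m)$. *)

(* Defs.v *)
From mathcomp Require Import all_boot all_order all_algebra.
From mathcomp Require Import boolp reals.

Set Implicit Arguments.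
Unset Strict Implicit.
Unset Printing Implicit Defensive.

Import Order.TTheory GRing.Theory Num.Theory.

Record sgraph (n : nat) := SGraph {
  adj :> rel 'I_n;
  adj_sym : symmetric adj;
  adj_irr : irreflexive adj }.

Section Graphs.
Variable n : nat.
Implicit Types (G H : sgraph n) (u v : 'I_n).

Definition edges G : {set {set 'I_n}} :=
  [set [set p.1; p.2] | p : 'I_n * 'I_n & adj G p.1 p.2].

Definition walk G u v (d : nat) : bool :=
  [exists p : d.-tuple 'I_n, path (adj G) u p && (last u p == v)].

(* [None] is the infinite distance between different components. *)
Definition dist G u v : option nat :=
  if pselect (exists d, walk G u v d) is left ex then Some (ex_minn ex)
  else None.

Definition le_dist (a b : option nat) : bool :=
  match a, b with
  | _, None => true
  | Some x, Some y => x <= y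
  | None, Some _ => false
  end.

Definition additive_spanner (k : nat) G H : Prop :=
  edges H \subset edges G /\
  forall u v, le_dist (dist H u v) (omap (addn^~ k) (dist G u v)).

(* The edges of [G], each listed exactly once, in an arbitrary order and with
   an arbitrary orientation. *)
Definition edge_list G (es : seq ('I_n * 'I_n)) : Prop :=
  uniq [seq [set e.1; e.2] | e <- es] /\
  [seq [set e.1; e.2] | e <- es] =i edges G.

Definition encode (es : seq ('I_n * 'I_n)) : seq nat :=
  [:: n, size es & flatten [seq [:: val e.1; val e.2] | e <- es]].

End Graphs.

(* The word RAM.

   A machine with [w]-bit words: a program is a fixed finite list of
   instructions, each of which takes one unit of time.  Words are naturals
   smaller than [2 ^ w], and arithmetic is modulo [2 ^ w]. *)

Inductive binop :=
  | OpAdd | OpSub | OpMul | OpDiv | OpMod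
  | OpAnd | OpOr | OpXor | OpShl | OpShr.

Definition eval_binop (w : nat) (o : binop) (x y : nat) : nat :=
  match o with
  | OpAdd => x + y
  | OpSub => x + 2 ^ w - y
  | OpMul => x * y
  | OpDiv => x %/ y
  | OpMod => x %% y
  | OpAnd => Nat.land x y
  | OpOr  => Nat.lor x y
  | OpXor => Nat.lxor x y
  | OpShl => x * 2 ^ y
  | OpShr => x %/ 2 ^ y
  end %% 2 ^ w.

(* Registers are written [r], [a], [b]; [l] is a position in the program. *)
Inductive instr :=
  | Const (r c : nat)               (* r := c *)
  | Binop (o : binop) (r a b : nat) (* r := a o b *)
  | Read (r a : nat)                (* r := mem[a] *)
  | Write (a r : nat)               (* mem[a] := r *)
  | Jump (l : nat)
  | JumpEq (a b l : nat)            (* if a = b then goto l *)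
  | JumpLt (a b l : nat)            (* if a < b then goto l *)
  | Halt.

Definition program := seq instr.

Record state := State {
  pc : nat;
  reg : nat -> nat;
  mem : nat -> nat }.

(* No successor state on [Halt], nor outside of the program. *)
Definition step (w : nat) (P : program) (s : state) : option state :=
  let: State i r m := s in
  match onth P i with
  | Some (Const x c) => Some (State i.+1 [eta r with x |-> c %% 2 ^ w] m)
  | Some (Binop o x a b) =>
      Some (State i.+1 [eta r with x |-> eval_binop w o (r a) (r b)] m)
  | Some (Read x a) => Some (State i.+1 [eta r with x |-> m (r a)] m)
  | Some (Write a x) => Some (State i.+1 r [eta m with r a |-> r x])
  | Some (Jump l) => Some (State l r m)
  | Some (JumpEq a b l) => Some (State (if r a == r b then l else i.+1) r m)
  | Some (JumpLt a b l) => Some (State (if r a < r b then l else i.+1) r m)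
  | Some Halt | None => None
  end.

(* [exec w P s t s']: started in [s], [P] halts in [s'] after executing [t]
   instructions.  The final [Halt] counts, so every running time is positive;
   leaving the program without [Halt] is not termination. *)
Inductive exec (w : nat) (P : program) : state -> nat -> state -> Prop :=
  | exec_halt s : onth P (pc s) = Some Halt -> exec w P s 1 s
  | exec_step s s1 t s2 :
      step w P s = Some s1 -> exec w P s1 t s2 -> exec w P s t.+1 s2.

Definition init (input : seq nat) : state :=
  State 0 (fun=> 0) (fun i => nth 0 input i).

(* The memory contents beyond the output are irrelevant. *)
Definition holds_output (s : state) (output : seq nat) : Prop :=
  forall i, i < size output -> mem s i = nth 0 output i.

Local Open Scope ring_scope.

(* The word length is only assumed to be [w >= c * log2 (n + m + 2)] for some
   constant [c] depending on the program; this makes room for numbers and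
   addresses polynomial in the size of the input (for [c >= 2] the input itself
   fits), and enlarging [c] only weakens the requirement.  The bounds on
   the running time and on the spanner size are uniform in [w].
   Since the constants [Cf] and [Cg] are positive, the bounds force [f] to be
   nonnegative and [g] to be positive on all [(n, m)] realised by a graph. *)
Definition spanner_algorithm (R : realType) (k : nat)
    (f g : nat -> nat -> R) : Prop :=
  exists (P : program) (c : nat) (Cf Cg : R), [/\ 0 < Cf, 0 < Cg &
    forall (n : nat) (G : sgraph n) (es : seq ('I_n * 'I_n)) (w : nat),
      let m := #|edges G| in
      edge_list G es -> ((n + m + 2) ^ c <= 2 ^ w)%N ->
      exists (t : nat) (s : state) (H : sgraph n) (hs : seq ('I_n * 'I_n)),
        [/\ exec w P (init (encode es)) t s,
            holds_output s (encode hs) /\ edge_list H hs,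
            additive_spanner k G H,
            #|edges H|%:R <= Cf * f n m &
            t%:R <= Cg * g n m]].

(* Main.v *)
(* Run the given algorithm on the bipartite double cover of G: the vertices are
   pairs (u, b) with b a bit, encoded as 2u + b, and the edges are the pairs
   (u, b)(v, 1 - b) with uv an edge of G.  It has 2n vertices and 2m edges.  All
   walks between two given vertices of a bipartite graph have lengths of the same
   parity, so a (2k+1)-additive spanner of the cover is automatically 2k-additive,
   and its projection to G is a 2k-additive spanner of G with at most as many
   edges.

   The projection may produce an edge twice.  Duplicates are removed in time O(1)
   per edge by means of an n * n table that is never initialised. *)

Require Import Defs.
From mathcomp Require Import all_boot all_order all_algebra.
From mathcomp Require Import boolp reals zify lra.

Set Implicit Arguments.
Unset Strict Implicit.
Unset Printing Implicit Defensive.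

Import Order.TTheory GRing.Theory Num.Theory.

(** * Graphs and the double cover *)

Lemma set2_eq (T : finType) (a b c d : T) :
  [set a; b] = [set c; d] -> a = c /\ b = d \/ a = d /\ b = c.
Proof.
move=> E.
have Ea : a \in [set c; d] by rewrite -E set21.
have Eb : b \in [set c; d] by rewrite -E set22.
have Ec : c \in [set a; b] by rewrite E set21.
have Ed : d \in [set a; b] by rewrite E set22.
move: Ea Eb Ec Ed; rewrite !inE.
by do 4![case/orP=> /eqP ?]; subst; auto.
Qed.

Lemma mem_edges n (G : sgraph n) u v : ([set u; v] \in edges G) = adj G u v.
Proof.
apply/imsetP/idP => [[[a b]] /=|Guv]; last by exists (u, v); rewrite ?inE.
by rewrite inE /= => Gab /set2_eq[[-> ->]|[-> ->]] //; rewrite adj_sym.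
Qed.

Lemma edges_subP n (H G : sgraph n) :
  reflect (subrel (adj H) (adj G)) (edges H \subset edges G).
Proof.
apply: (iffP subsetP) => [sHG u v|sHG S /imsetP[[u v]]].
  by rewrite -!mem_edges; apply: sHG.
by rewrite inE /= => /sHG Guv ->; rewrite mem_edges.
Qed.

Lemma edge_listP n (G : sgraph n) es u v : edge_list G es ->
  reflect (exists2 e, e \in es & [set e.1; e.2] = [set u; v]) (adj G u v).
Proof.
case=> _ E; rewrite -mem_edges -E.
by apply: (iffP mapP) => -[e ees Ee]; exists e.
Qed.

Lemma edge_list_inj n (G : sgraph n) es : edge_list G es ->
  {in es &, injective (fun e => [set e.1; e.2])}.
Proof.
case=> + _; elim: es => //= e0 es IHes /andP[nin /IHes inj] e e'.
rewrite !inE => /predU1P[->|ein] /predU1P[->|e'in] //; last exact: inj.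
  by move=> E; case/mapP: nin; exists e'.
by move=> E; case/mapP: nin; exists e.
Qed.

Lemma edge_listI n (G : sgraph n) es : uniq es ->
    {in es &, injective (fun e => [set e.1; e.2])} ->
    {in es, forall e, adj G e.1 e.2} ->
    (forall u v, adj G u v ->
      exists2 e, e \in es & [set e.1; e.2] = [set u; v]) ->
  edge_list G es.
Proof.
move=> U inj sub sup; split=> [|S]; first by rewrite map_inj_in_uniq.
apply/mapP/idP => [[e /sub + ->]|/imsetP[[u v]]]; first by rewrite mem_edges.
by rewrite inE /= => /sup[e ees Ee] ->; exists e.
Qed.

Lemma edge_list_adj n (G : sgraph n) es e :
  edge_list G es -> e \in es -> adj G e.1 e.2.
Proof. by move=> Ges ees; apply/(edge_listP _ _ Ges); exists e. Qed.

Lemma size_edge_list n (G : sgraph n) es :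
  edge_list G es -> #|edges G| = size es.
Proof.
by case=> U E; rewrite -(eq_card E) (card_uniqP U) size_map.
Qed.

Lemma walk0 n (G : sgraph n) u v : walk G u v 0 = (u == v).
Proof.
apply/existsP/eqP => [[p]|->]; last by exists [tuple]; rewrite /= eqxx.
by rewrite (tuple0 p) /= => /eqP.
Qed.

Lemma walkSP n (G : sgraph n) u v d :
  reflect (exists2 x, adj G u x & walk G x v d) (walk G u v d.+1).
Proof.
apply: (iffP existsP) => [[p]|[x Gux /existsP[p]]].
  case/tupleP: p => x p /= /andP[/andP[Gux Gp] lp].
  by exists x => //; apply/existsP; exists p; rewrite Gp.
by exists (cons_tuple x p); rewrite /= Gux.
Qed.

Lemma walk_homo n n' (G : sgraph n) (G' : sgraph n') (h : 'I_n -> 'I_n') d u v :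
  {homo h : x y / adj G x y >-> adj G' x y} ->
  walk G u v d -> walk G' (h u) (h v) d.
Proof.
move=> hom; elim: d u => [|d IHd] u; first by rewrite !walk0 => /eqP->.
by case/walkSP=> x /hom Gux /IHd Wxv; apply/walkSP; exists (h x).
Qed.

Lemma dist_walk n (G : sgraph n) u v d : dist G u v = Some d -> walk G u v d.
Proof. by rewrite /dist; case: pselect => // ex [<-]; case: ex_minnP. Qed.

Lemma walk_dist n (G : sgraph n) u v d :
  walk G u v d -> exists2 d', d' <= d & dist G u v = Some d'.
Proof.
move=> W; rewrite /dist; case: pselect => [ex|[]]; last by exists d.
by case: ex_minnP => d' _ min; exists d' => //; apply: min.
Qed.

(** Trades distances, with their infinite value, for walks: a finite [dist] is realised by a walk,
    and every walk bounds it from above. *)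
Lemma additive_spannerP n (G H : sgraph n) k :
  additive_spanner k G H <-> subrel (adj H) (adj G) /\
    forall u v d, walk G u v d -> exists2 d', d' <= d + k & walk H u v d'.
Proof.
split=> -[sHG dH]; split; try exact/edges_subP.
  move=> u v d /walk_dist[d0 led Ed]; move: (dH u v); rewrite Ed /=.
  case EH: (dist H u v) => [d'|//] /= led'; exists d'; last exact: dist_walk.
  by rewrite (leq_trans led') // leq_add2r.
move=> u v; case EG: (dist G u v) => [d|] /=; last by case: (dist H u v).
have [d' led' /walk_dist[d1 led1 ->]] := dH _ _ _ (dist_walk EG).
exact: leq_trans led'.
Qed.

(** * The double cover, the projection, and walks in them *)

Lemma half_subproof n (x : 'I_(2 * n)) : x./2 < n.
Proof. by have := ltn_ord x; lia. Qed.
Definition halfo n (x : 'I_(2 * n)) : 'I_n := Ordinal (half_subproof x).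

Lemma layer_subproof n (b : bool) (u : 'I_n) : b + u.*2 < 2 * n.
Proof. by have := ltn_ord u; lia. Qed.
Definition layer n (b : bool) (u : 'I_n) : 'I_(2 * n) :=
  Ordinal (layer_subproof b u).

Lemma layerK n b : cancel (@layer n b) (@halfo n).
Proof. by move=> u; apply/val_inj; rewrite /= half_bit_double. Qed.

Lemma odd_layer n b (u : 'I_n) : odd (layer b u) = b.
Proof. by rewrite /= oddD odd_double addbF oddb. Qed.

Lemma halfoK n (x : 'I_(2 * n)) : layer (odd x) (halfo x) = x.
Proof. by apply/val_inj; rewrite /= odd_double_half. Qed.

Lemma layer_eq n b c (u v : 'I_n) :
  (layer b u == layer c v) = (b == c) && (u == v).
Proof.
apply/eqP/andP => [E|[/eqP-> /eqP->]] //.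
by rewrite -(odd_layer b u) -{2}(layerK b u) E odd_layer layerK.
Qed.

Definition cover_adj n (G : sgraph n) : rel 'I_(2 * n) :=
  fun x y => adj G (halfo x) (halfo y) && (odd x != odd y).

Lemma cover_sym n (G : sgraph n) : symmetric (cover_adj G).
Proof. by move=> x y; rewrite /cover_adj adj_sym eq_sym. Qed.

Lemma cover_irr n (G : sgraph n) : irreflexive (cover_adj G).
Proof. by move=> x; rewrite /cover_adj adj_irr. Qed.

Definition double_cover n (G : sgraph n) := SGraph (cover_sym G) (cover_irr G).

(** The condition [u != v] makes this a simple graph for every [H], even one with an edge between
    the two copies of a vertex. *)
Definition proj_adj n (H : sgraph (2 * n)) : rel 'I_n :=
  fun u v => (u != v) &&
    [exists x, exists y, [&& halfo x == u, halfo y == v & adj H x y]].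

Lemma proj_sym n (H : sgraph (2 * n)) : symmetric (proj_adj H).
Proof.
suff sub u v : proj_adj H u v -> proj_adj H v u.
  by move=> u v; apply/idP/idP; apply: sub.
case/andP=> neq /existsP[x /existsP[y /and3P[xu yv Hxy]]].
rewrite /proj_adj eq_sym neq; apply/existsP; exists y; apply/existsP; exists x.
by rewrite yv xu adj_sym.
Qed.

Lemma proj_irr n (H : sgraph (2 * n)) : irreflexive (proj_adj H).
Proof. by move=> u; rewrite /proj_adj eqxx. Qed.

Definition project_graph n (H : sgraph (2 * n)) := SGraph (proj_sym H) (proj_irr H).

Lemma project_graphP n (H : sgraph (2 * n)) u v :
  reflect (u != v /\ exists x y, [/\ halfo x = u, halfo y = v & adj H x y])
          (adj (project_graph H) u v).
Proof.
apply: (iffP andP) => -[neq]; last first.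
  case=> x [y [xu yv Hxy]]; split=> //.
  by apply/existsP; exists x; apply/existsP; exists y; rewrite xu yv !eqxx.
case/existsP=> x /existsP[y /and3P[/eqP xu /eqP yv Hxy]].
by split=> //; exists x, y.
Qed.

Lemma adj_neq n (G : sgraph n) u v : adj G u v -> u != v.
Proof. by apply: contraTneq => ->; rewrite adj_irr. Qed.

Lemma cover_layer n (G : sgraph n) b u v :
  adj (double_cover G) (layer b u) (layer (~~ b) v) = adj G u v.
Proof. by rewrite /= /cover_adj !layerK !odd_layer; case: b; rewrite andbT. Qed.

Lemma walk_lift n (G : sgraph n) u v b d :
  walk G u v d -> walk (double_cover G) (layer b u) (layer (b (+) odd d) v) d.
Proof.
elim: d u b => [|d IHd] u b; first by rewrite !walk0 addbF => /eqP->.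
case/walkSP=> x Gux /(IHd _ (~~ b)); rewrite addNb -addbN => W.
by apply/walkSP; exists (layer (~~ b) x); rewrite ?cover_layer.
Qed.

Lemma walk_parity n (G : sgraph n) x y d :
  walk (double_cover G) x y d -> odd y = odd x (+) odd d.
Proof.
elim: d x => [|d IHd] x; first by rewrite walk0 addbF => /eqP->.
case/walkSP=> z /andP[_ neq] /IHd->; move: neq.
by rewrite /=; do 3!case: odd.
Qed.

Lemma proj_spanner n (G : sgraph n) (H : sgraph (2 * n)) k :
  additive_spanner (2 * k + 1) (double_cover G) H ->
  additive_spanner (2 * k) G (project_graph H).
Proof.
case/additive_spannerP=> sHG dH; apply/additive_spannerP; split.
  by move=> u v /project_graphP[_ [x [y [<- <- /sHG/andP[]]]]].
move=> u v d /(walk_lift false)/dH[d' led' W].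
(* Seen as a walk of the cover, the walk in [H] has its parity fixed by its ends. *)
have {}sHG' : walk (double_cover G) (layer false u) (layer (odd d) v) d'.
  by apply: (walk_homo (h := id)) W => x y /sHG.
exists d'.
  have := walk_parity sHG'; rewrite !odd_layer /= => odd_d.
  (* [d'] has the parity of [d], so the extreme value [d + (2 * k + 1)] is excluded and the bound
     drops by one. *)
  by have: d' != d + (2 * k + 1); [apply/eqP => E; move: odd_d; lia | lia].
rewrite -[u](layerK false) -[v](layerK (odd d)).
apply: walk_homo W => x y Hxy; apply/project_graphP; split; last by exists x, y.
by have /andP[/adj_neq] := sHG _ _ Hxy.
Qed.

(** * Edge lists of the cover and of the projection *)

(** The order is the one the machine produces: the first half overwrites the input, the second is
    appended. *)
Definition cover_edges n (es : seq ('I_n * 'I_n)) :=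
  [seq (layer false e.1, layer true e.2) | e <- es] ++
  [seq (layer false e.2, layer true e.1) | e <- es].

Lemma set_layer_eq n (a b c d : 'I_n) :
  [set layer false a; layer true b] = [set layer false c; layer true d] ->
  a = c /\ b = d.
Proof.
by move/set2_eq; case=> -[] /eqP + /eqP; rewrite !layer_eq //= =>
  /eqP-> /eqP->.
Qed.

Lemma mem_cover_edges n (es : seq ('I_n * 'I_n)) x y :
  reflect (exists u v, [/\ x = layer false u, y = layer true v
                         & (u, v) \in es \/ (v, u) \in es])
          ((x, y) \in cover_edges es).
Proof.
rewrite mem_cat; apply: (iffP orP).
  case=> /mapP[[u v] uv [-> ->]] /=; [exists u, v | exists v, u].
    by split=> //; left.
  by split=> //; right.
case=> u [v [-> -> [] uv]]; [left | right]; apply/mapP.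
  by exists (u, v).
by exists (v, u).
Qed.

Lemma cover_edge_list n (G : sgraph n) es :
  edge_list G es -> edge_list (double_cover G) (cover_edges es).
Proof.
move=> Ges; have [/map_uniq U _] := Ges; apply: edge_listI.
- have inj : injective (fun e : 'I_n * 'I_n => (layer false e.1, layer true e.2)).
    by move=> [a b] [c d] /eqP; rewrite xpair_eqE !layer_eq /= => /andP[/eqP-> /eqP->].
  have inj' : injective (fun e : 'I_n * 'I_n => (layer false e.2, layer true e.1)).
    by move=> [a b] [c d] /eqP; rewrite xpair_eqE !layer_eq /= => /andP[/eqP-> /eqP->].
  rewrite cat_uniq !map_inj_uniq ?U ?andbT //=.
  (* A pair in both halves comes from [(a, b)] and its reversal, both listed; listing each edge once
     makes them equal, so the edge is a loop. *)
  apply/hasPn=> _ /mapP[[a b] ab ->]; apply/mapP => -[[c d] cd /= /eqP].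
  rewrite xpair_eqE !layer_eq /= => /andP[/eqP bc /eqP ad].
  have := edge_list_adj Ges cd.
  have [] : (a, b) = (c, d).
    by apply: (edge_list_inj Ges) => //=; rewrite bc ad setUC.
  by move=> ac _; rewrite /= -ac ad adj_irr.
- move=> [x y] [x' y'] /mem_cover_edges[u [v [-> -> _]]].
  by case/mem_cover_edges=> u' [v' [-> -> _]] /set_layer_eq[-> ->].
- move=> [x y] /mem_cover_edges[u [v [-> -> uv]]].
  rewrite (cover_layer G false).
  by case: uv => /(edge_list_adj Ges); rewrite // adj_sym.
move=> x y /andP[/(edge_listP _ _ Ges)[[a b] ab]] /set2_eq ab_xy neq.
have xy : (halfo x, halfo y) \in es \/ (halfo y, halfo x) \in es.
  by move: ab_xy => /= [] [<- <-]; auto.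
(* The listed orientation goes from the even end to the odd end. *)
rewrite -[x]halfoK -[y]halfoK; move: neq.
case: (odd x); case: (odd y) => // _.
  exists (layer false (halfo y), layer true (halfo x)); last by rewrite setUC.
  by apply/mem_cover_edges; exists (halfo y), (halfo x); split=> //; case: xy; auto.
exists (layer false (halfo x), layer true (halfo y)) => //.
by apply/mem_cover_edges; exists (halfo x), (halfo y).
Qed.

(** Sorting the ends gives each undirected edge a single representative, so duplicates become equal
    pairs. *)
Definition proj_edge n (e : 'I_(2 * n) * 'I_(2 * n)) : 'I_n * 'I_n :=
  let u := halfo e.1 in let v := halfo e.2 in if u < v then (u, v) else (v, u).

(** [undup] keeps last occurrences; the two reversals make it keep first ones, as a machine scanning
    the list does. *)
Definition proj_edges n (hs : seq ('I_(2 * n) * 'I_(2 * n))) :=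
  rev (undup (rev [seq proj_edge e | e <- hs])).

Lemma proj_edge_set n (e : 'I_(2 * n) * 'I_(2 * n)) :
  [set (proj_edge e).1; (proj_edge e).2] = [set halfo e.1; halfo e.2].
Proof. by rewrite /proj_edge; case: ifP => // _; rewrite setUC. Qed.

Lemma proj_edge_le n (e : 'I_(2 * n) * 'I_(2 * n)) :
  (proj_edge e).1 <= (proj_edge e).2.
Proof. by rewrite /proj_edge; case: (ltnP (halfo e.1) (halfo e.2)) => //= /ltnW. Qed.

Lemma proj_edge_list n (G : sgraph n) (H : sgraph (2 * n)) hs :
  subrel (adj H) (adj (double_cover G)) ->
  edge_list H hs -> edge_list (project_graph H) (proj_edges hs).
Proof.
move=> sHG Hhs.
have mem e : reflect (exists2 h, h \in hs & e = proj_edge h)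
                     (e \in proj_edges hs).
  by rewrite mem_rev mem_undup mem_rev; apply: mapP.
apply: edge_listI; first by rewrite rev_uniq undup_uniq.
- move=> _ _ /mem[h _ ->] /mem[h' _ ->] /set2_eq.
  have := proj_edge_le h; have := proj_edge_le h'.
  case: (proj_edge h) (proj_edge h') => a b [c d] /= lecd leab.
  case=> [[-> ->] //|[ad bc]]; subst.
  by have -> : d = c by apply/val_inj/anti_leq/andP.
- move=> _ /mem[h /(edge_list_adj Hhs) Hh ->]; rewrite -mem_edges.
  rewrite proj_edge_set mem_edges; apply/project_graphP; split; last by exists h.1, h.2.
  by have /andP[/adj_neq] := sHG _ _ Hh.
move=> _ _ /project_graphP[_ [x [y [<- <- /(edge_listP _ _ Hhs)[h hhs]]]]].
move/set2_eq=> h_xy; exists (proj_edge h); first by apply/mem; exists h.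
by rewrite proj_edge_set; case: h_xy => -[-> ->] //; rewrite setUC.
Qed.

Lemma size_proj_edges n (hs : seq ('I_(2 * n) * 'I_(2 * n))) :
  size (proj_edges hs) <= size hs.
Proof. by rewrite size_rev (leq_trans (size_undup _)) // size_rev size_map. Qed.

(** * Composition of programs *)

Definition reloc (off : nat) (fin : instr) (i : instr) : instr :=
  match i with
  | Jump l => Jump (off + l)
  | JumpEq a b l => JumpEq a b (off + l)
  | JumpLt a b l => JumpLt a b (off + l)
  | Halt => fin
  | i => i
  end.

Definition seqprog (A B : program) : program :=
  map (reloc 0 (Jump (size A))) A ++ map (reloc (size A) Halt) B.

Definition shift (off : nat) (s : state) : state :=
  State (off + pc s) (reg s) (Defs.mem s).

(** [Halt] has no successor, so a step never meets the replaced instruction and [fin] is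
    arbitrary. *)
Lemma step_reloc w (C Q : program) off fin s s1 :
  (forall i ins, onth C i = Some ins ->
     onth Q (off + i) = Some (reloc off fin ins)) ->
  step w C s = Some s1 -> step w Q (shift off s) = Some (shift off s1).
Proof.
case: s => i r m /= CQ; case E: (onth C i) => [ins|//]; rewrite (CQ _ _ E).
by case: ins {E} => [r0 c|o r0 a b|r0 a|a r0|l|a b l|a b l|] //= [<-];
  rewrite /shift /= -?addnS //; case: ifP.
Qed.

Lemma onth_seqprogl A B i ins : onth A i = Some ins ->
  onth (seqprog A B) (0 + i) = Some (reloc 0 (Jump (size A)) ins).
Proof.
move=> E; have := onthTE A i; rewrite E /= => /esym ltiA.
by rewrite /seqprog onth_cat size_map ltiA onth_map E.
Qed.

Lemma onth_seqprogr A B i ins : onth B i = Some ins ->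
  onth (seqprog A B) (size A + i) = Some (reloc (size A) Halt ins).
Proof.
by move=> E; rewrite /seqprog onth_cat size_map ltnNge leq_addr addKn /= onth_map E.
Qed.

(** The times add up exactly: the final [Halt] of [A], already counted in [tA], becomes the jump to
    [B]. *)
Lemma exec_seqprog w A B s tA sA tB sB :
  exec w A s tA sA -> exec w B (State 0 (reg sA) (Defs.mem sA)) tB sB ->
  exec w (seqprog A B) s (tA + tB) (shift (size A) sB).
Proof.
have shift0 s0 : shift 0 s0 = s0 by case: s0.
move=> exA exB; elim: exA exB => {s tA sA} [s Hs|s s1 t s2 Hs _ IH] exB.
  rewrite add1n.
  apply: (@exec_step _ _ _ (shift (size A) (State 0 (reg s) (Defs.mem s)))).
    case: s Hs exB => i r m /= /(onth_seqprogl B) /= -> _.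
    by rewrite /shift addn0.
  elim: exB => {tB sB} [s0 H0|s0 s1 t s2 H0 _ IH].
    by apply: exec_halt; rewrite (onth_seqprogr _ H0).
  apply: exec_step IH; apply: step_reloc H0; exact: onth_seqprogr.
rewrite addSn; apply: exec_step (IH exB).
by rewrite -(shift0 s) -(shift0 s1); apply: step_reloc Hs; apply: onth_seqprogl.
Qed.

(** * Symbolic execution within a time budget *)

Definition exec_le w P s T (Q : state -> Prop) :=
  exists t s', [/\ t <= T, exec w P s t s' & Q s'].

(** The first registers form an explicit list on which execution computes; the others are those of
    [r]. *)
Definition regs (l : seq nat) (r : nat -> nat) : nat -> nat :=
  fun i => nth (r i) l i.

Lemma regs_set l r x v : x < size l ->
  [eta regs l r with x |-> v] = regs (set_nth 0 l x v) r :> (nat -> nat).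
Proof.
move=> ltxl; apply/funext => i; rewrite /regs /=.
have sz : size (set_nth 0 l x v) = size l by rewrite size_set_nth; lia.
case: (ltnP i (size l)) => [lti|lei]; last first.
  by rewrite !nth_default ?sz //; case: eqP lei => // ->; lia.
rewrite [RHS](set_nth_default 0) ?sz // nth_set_nth /=.
by rewrite (set_nth_default 0 (r i) lti).
Qed.

Lemma regs_nth l r a : a < size l -> regs l r a = nth 0 l a.
Proof. exact: set_nth_default. Qed.

Lemma exec_le_step w P s s1 T Q :
  step w P s = Some s1 -> exec_le w P s1 T Q -> exec_le w P s T.+1 Q.
Proof.
by move=> st [t [s' [le_tT ex Qs']]]; exists t.+1, s'; split=> //; apply: exec_step ex.
Qed.

Lemma exec_le_weaken w P s T T' Q :
  T <= T' -> exec_le w P s T Q -> exec_le w P s T' Q.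
Proof.
by move=> leT [t [s' [le_tT ex Qs']]]; exists t, s'; split=> //; apply: leq_trans leT.
Qed.

Lemma exec_le_halt w P s T (Q : state -> Prop) :
  onth P (pc s) = Some Halt -> Q s -> exec_le w P s T.+1 Q.
Proof. by move=> st Qs; exists 1, s; split=> //; apply: exec_halt. Qed.

Lemma run_const w P i l r m x c T Q :
  onth P i = Some (Const x c) -> x < size l -> c < 2 ^ w ->
  exec_le w P (State i.+1 (regs (set_nth 0 l x c) r) m) T Q ->
  exec_le w P (State i (regs l r) m) T.+1 Q.
Proof.
by move=> E ltx ltc; apply: exec_le_step; rewrite /= E modn_small // regs_set.
Qed.

(** The result [v] is tied by an equation, so that a proof of no overflow replaces the modular
    expression by a plain one. *)
Lemma run_binop w P i l r m o x a b v T Q :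
  onth P i = Some (Binop o x a b) -> [&& x < size l, a < size l & b < size l] ->
  eval_binop w o (nth 0 l a) (nth 0 l b) = v ->
  exec_le w P (State i.+1 (regs (set_nth 0 l x v) r) m) T Q ->
  exec_le w P (State i (regs l r) m) T.+1 Q.
Proof.
move=> E /and3P[ltx lta ltb] <-; apply: exec_le_step.
by rewrite /= E regs_set // !regs_nth.
Qed.

Lemma run_read w P i l r m x a v T Q :
  onth P i = Some (Read x a) -> (x < size l) && (a < size l) ->
  m (nth 0 l a) = v ->
  exec_le w P (State i.+1 (regs (set_nth 0 l x v) r) m) T Q ->
  exec_le w P (State i (regs l r) m) T.+1 Q.
Proof.
move=> E /andP[ltx lta] <-; apply: exec_le_step.
by rewrite /= E regs_set // !regs_nth.
Qed.

Lemma run_write w P i l r m x a T Q :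
  onth P i = Some (Write a x) -> (x < size l) && (a < size l) ->
  exec_le w P (State i.+1 (regs l r) [eta m with nth 0 l a |-> nth 0 l x]) T Q ->
  exec_le w P (State i (regs l r) m) T.+1 Q.
Proof.
move=> E /andP[ltx lta]; apply: exec_le_step.
by rewrite /= E !regs_nth.
Qed.

Lemma run_jump w P i r m j T Q :
  onth P i = Some (Jump j) ->
  exec_le w P (State j r m) T Q -> exec_le w P (State i r m) T.+1 Q.
Proof. by move=> E; apply: exec_le_step; rewrite /= E. Qed.

Lemma run_jumpeq w P i l r m a b j c T Q :
  onth P i = Some (JumpEq a b j) -> (a < size l) && (b < size l) ->
  (nth 0 l a == nth 0 l b) = c ->
  exec_le w P (State (if c then j else i.+1) (regs l r) m) T Q ->
  exec_le w P (State i (regs l r) m) T.+1 Q.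
Proof.
move=> E /andP[lta ltb] <-; apply: exec_le_step; rewrite /= E !regs_nth //.
Qed.

Lemma run_jumplt w P i l r m a b j c T Q :
  onth P i = Some (JumpLt a b j) -> (a < size l) && (b < size l) ->
  (nth 0 l a < nth 0 l b) = c ->
  exec_le w P (State (if c then j else i.+1) (regs l r) m) T Q ->
  exec_le w P (State i (regs l r) m) T.+1 Q.
Proof.
move=> E /andP[lta ltb] <-; apply: exec_le_step; rewrite /= E !regs_nth //.
Qed.

Lemma eval_add w x y : x + y < 2 ^ w -> eval_binop w OpAdd x y = x + y.
Proof. exact: modn_small. Qed.

Lemma eval_mul w x y : x * y < 2 ^ w -> eval_binop w OpMul x y = x * y.
Proof. exact: modn_small. Qed.

Lemma eval_half w x : x < 2 ^ w -> eval_binop w OpShr x 1 = x./2.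
Proof. by move=> ltx; rewrite /eval_binop expn1 divn2 modn_small; lia. Qed.

Lemma update_nth (a b : seq nat) x v i : i = size a ->
  [eta nth 0 (a ++ x :: b) with i |-> v] = nth 0 (a ++ v :: b) :> (nat -> nat).
Proof.
move=> ->; apply/funext => j; rewrite /= !nth_cat.
by case: ltngtP => //= [ltj|->]; [rewrite -(subnSK ltj)|rewrite subnn].
Qed.

(** Cells past the end of the list read as 0, so writing to the first of them appends. *)
Lemma update_nth_last (a : seq nat) v i : i = size a ->
  [eta nth 0 a with i |-> v] = nth 0 (a ++ [:: v]) :> (nat -> nat).
Proof.
move=> ->; apply/funext => j; rewrite /= cats1 nth_rcons.
by case: ltngtP => // ltj; rewrite nth_default // ltnW.
Qed.

Lemma update_nth1 (a b : seq nat) y x v i : i = (size a).+1 ->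
  [eta nth 0 (a ++ [:: y, x & b]) with i |-> v] =
  nth 0 (a ++ [:: y, v & b]) :> (nat -> nat).
Proof.
move=> Ei; rewrite -!(cat_rcons y); apply: update_nth.
by rewrite size_rcons.
Qed.

Lemma nth_at (a b : seq nat) x i : i = size a -> nth 0 (a ++ x :: b) i = x.
Proof. by move=> ->; rewrite nth_cat ltnn subnn. Qed.

Lemma nth_at1 (a b : seq nat) y x i :
  i = (size a).+1 -> nth 0 (a ++ [:: y, x & b]) i = x.
Proof. by move=> Ei; rewrite -cat_rcons nth_at ?size_rcons. Qed.

Ltac run :=
  first [ apply: run_const; [reflexivity|by []| |]
        | apply: run_binop; [reflexivity|by []| |]
        | apply: run_read; [reflexivity|by []| |]
        | apply: run_write; [reflexivity|by []|]
        | apply: run_jump; [reflexivity|] ].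

Ltac branch c :=
  first [ apply: (@run_jumpeq _ _ _ _ _ _ _ _ _ c); [reflexivity|by []| |]
        | apply: (@run_jumplt _ _ _ _ _ _ _ _ _ c); [reflexivity|by []| |] ];
  rewrite /=.

Ltac add := run; [by apply: eval_add; rewrite /=; lia|]; rewrite /=.

(** * From a graph to its double cover *)

(* Registers: 0, next edge of the input; 1, next free cell; 2, end of the input;
   3 and 4, edge being processed; 5, the constant 1.  The edge (2u, 2v+1)
   overwrites uv and (2v, 2u+1) is appended.  The program clears its registers,
   since the next one must start in an initial state. *)
Definition cover_program : program :=
  [:: Const 5 1; Read 3 0; Binop OpAdd 3 3 3; Write 0 3;
      Read 3 5; Binop OpAdd 3 3 3; Write 5 3;
      Const 0 2; Binop OpAdd 2 0 3; Binop OpAdd 1 2 4;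
      JumpEq 0 2 26;
      Read 3 0; Binop OpAdd 3 3 3; Write 0 3; Binop OpAdd 0 0 5;
      Read 4 0; Binop OpAdd 4 4 4; Write 1 4; Binop OpAdd 4 4 5;
      Write 0 4; Binop OpAdd 0 0 5; Binop OpAdd 1 1 5;
      Binop OpAdd 3 3 5; Write 1 3; Binop OpAdd 1 1 5; Jump 10;
      Const 0 0; Const 1 0; Const 2 0; Const 3 0; Const 4 0; Const 5 0; Halt].

Definition flat (es : seq (nat * nat)) : seq nat :=
  flatten [seq [:: e.1; e.2] | e <- es].

Lemma size_flat es : size (flat es) = (size es).*2.
Proof. by elim: es => //= e es ->. Qed.

Lemma flat_cat es es' : flat (es ++ es') = flat es ++ flat es'.
Proof. by rewrite /flat map_cat flatten_cat. Qed.

Definition lowers (es : seq (nat * nat)) := [seq (e.1.*2, e.2.*2.+1) | e <- es].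
Definition uppers (es : seq (nat * nat)) := [seq (e.2.*2, e.1.*2.+1) | e <- es].

(** Loop invariant: [es1] is processed, its lower copies in place and its upper copies after the
    input, whose end is [M]. An iteration takes 16 instructions; the exit test, six register resets
    and [Halt] take 8. All addresses stay below [M.*2]. *)
Lemma cover_program_loop w h es1 es2 n x3 x4 :
  let M := 2 + (size es1).*2 + (size es2).*2 in
  let m1 := nth 0 (h.1 :: h.2 :: flat (lowers es1 ++ es2 ++ uppers es1)) in
  let m2 := nth 0 (h.1 :: h.2 :: flat (lowers (es1 ++ es2) ++ uppers (es1 ++ es2))) in
  all (fun e => (e.1 < n) && (e.2 < n)) es2 ->
  M.*2 < 2 ^ w -> n.*2 < 2 ^ w ->
  exec_le w cover_program
   (State 10 (regs [:: 2 + (size es1).*2; M + (size es1).*2; M; x3; x4; 1] (fun=> 0)) m1)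
   (16 * size es2 + 8) (eq (State 32 (fun=> 0) m2)).
Proof.
elim: es2 es1 x3 x4 => [|[u v] es2 IH] es1 x3 x4 M m1 m2.
  move=> _ ltM ltn; branch true; first by rewrite /M addn0 eqxx.
  have W : 0 < 2 ^ w by lia.
  do 6![run => //]; rewrite /m1 /m2 !cats0 /=.
  have -> : regs [:: 0; 0; 0; 0; 0; 0] (fun=> 0) = fun=> 0.
    by apply/funext => i; rewrite /regs; do 6![case: i => [|i] //]; rewrite nth_default.
  exact: exec_le_halt.
move=> /= /andP[/andP[/= ltu ltv] lt_es] ltM ltn.
have EM : M = 2 + (size es1).*2 + (size es2).+1.*2 by [].
have W : 1 < 2 ^ w by lia.
have {IH} := IH (rcons es1 (u, v)); rewrite size_rcons cat_rcons mulnS -[16 + _ + 8]addnA.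
move: (16 * size es2 + 8) => T IH.
branch false; first by lia.
clearbody M.
(* The memory blocks are made opaque; the address computations use only their sizes. *)
have [A EA] : exists A, A = [:: h.1, h.2 & flat (lowers es1)] by eexists.
have [B EB] : exists B, B = flat (uppers es1) by eexists.
have szA : size A = 2 + (size es1).*2 by rewrite EA /= size_flat size_map.
have szB : size B = (size es1).*2 by rewrite EB size_flat size_map.
have [D ED] : exists D, D = flat es2 by eexists.
have szD : size D = (size es2).*2 by rewrite ED size_flat.
have -> : m1 = nth 0 (A ++ [:: u, v & D ++ B]).
  by rewrite /m1 !flat_cat EA EB ED.
run; first by apply: nth_at; rewrite szA.
add.
run; rewrite /= update_nth ?szA //.
add; rewrite addn1.
run; first by apply: nth_at1; rewrite /= szA.
add.
run; rewrite /= update_nth_last; last by rewrite size_cat /= size_cat; lia.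
add.
run; rewrite -catA /= update_nth1 ?szA //.
add; add; add; rewrite addn1.
run; rewrite /= update_nth_last; last by rewrite !size_cat /= !size_cat /=; lia.
add; run.
rewrite -catA /= -catA /= -catA.
have -> : A ++ [:: u + u, v + v + 1 & D ++ B ++ [:: v + v; u + u + 1]] =
    [:: h.1, h.2 & flat (lowers (rcons es1 (u, v)) ++ es2 ++ uppers (rcons es1 (u, v)))].
  rewrite /lowers /uppers !map_rcons -!cats1 !flat_cat EA EB ED /= -!catA /=.
  by rewrite !addnn !addn1.
have -> : (2 + (size es1).*2).+2 = 2 + (size es1).+1.*2 by lia.
have -> : M + (size es1).*2 + 1 + 1 = M + (size es1).+1.*2 by lia.
have {}EM : M = 2 + (size es1).+1.*2 + (size es2).*2 by lia.
by rewrite EM in ltM *; apply: IH.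
Qed.

(** The exact final registers and memory matter: with the counter reset, this is an [init] state,
    from which the given algorithm can start. *)
Lemma cover_program_exec w n es :
  all (fun e => (e.1 < n) && (e.2 < n)) es ->
  n.*2 < 2 ^ w -> 4 * size es + 4 < 2 ^ w ->
  exec_le w cover_program (init [:: n, size es & flat es]) (16 * size es + 18)
    (eq (State 32 (fun=> 0)
       (nth 0 [:: n.*2, (size es).*2 & flat (lowers es ++ uppers es)]))).
Proof.
move=> lt_es ltn ltm.
have W : 2 < 2 ^ w by lia.
have := @cover_program_loop w (n.*2, (size es).*2) [::] es n (size es).*2 0 lt_es.
rewrite (_ : 16 * size es + 18 = 10 + (16 * size es + 8)); last by lia.
move: (16 * size es + 8) => T /= IH.
have -> : init [:: n, size es & flat es] =
    State 0 (regs [:: 0; 0; 0; 0; 0; 0] (fun=> 0)) (nth 0 [:: n, size es & flat es]).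
  congr State; apply/funext => i; rewrite /regs.
  by do 6![case: i => [|i] //]; rewrite nth_default.
run; first by lia.
run; first by [].
add.
run; rewrite (@update_nth [::]) //=.
run; first by [].
add.
run; rewrite (@update_nth1 [::]) //=.
run; first by [].
add; add.
rewrite double0 cats0 !addn0 in IH.
by rewrite !addnn addn0; apply: IH; lia.
Qed.

(** * From a spanner of the double cover to a spanner *)

(* Registers: 0, next edge to read; 1, number of kept edges; 2, end of the input
   and base of the table; 3 and 4, ends of the projected edge, in increasing
   order from line 22 on; 5, 11 and 12, the constants 1, 2
   and 0; 6, number of vertices; 7, table address of the edge; 8, entry found
   there.  Kept edges overwrite the part of the input that was already read. *)
Definition project_program : program :=
  [:: Const 5 1; Const 12 0; Const 11 2; Read 6 12; Binop OpShr 6 6 5;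
      Write 12 6; Read 2 5; Binop OpAdd 2 2 2; Binop OpAdd 2 2 11;
      Const 0 2; Const 1 0;
      JumpEq 0 2 44;
      Read 3 0; Binop OpShr 3 3 5; Binop OpAdd 0 0 5;
      Read 4 0; Binop OpShr 4 4 5; Binop OpAdd 0 0 5;
      JumpLt 3 4 22;
      Binop OpAdd 10 3 12; Binop OpAdd 3 4 12; Binop OpAdd 4 10 12;
      Binop OpMul 7 6 3; Binop OpAdd 7 7 4; Binop OpAdd 7 7 2; Read 8 7;
      JumpLt 8 1 28; Jump 36;
      Binop OpAdd 9 8 8; Binop OpAdd 9 9 11; Read 10 9;
      JumpEq 10 3 33; Jump 36;
      Binop OpAdd 9 9 5; Read 10 9; JumpEq 10 4 11;
      Write 7 1; Binop OpAdd 9 1 1; Binop OpAdd 9 9 11; Write 9 3;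
      Binop OpAdd 9 9 5; Write 9 4; Binop OpAdd 1 1 5; Jump 11;
      Write 5 1; Halt].

(** Constrains only the listed cells, since the given algorithm leaves unknown contents beyond its
    output. *)
Definition stored (m : nat -> nat) p s := forall j, j < size s -> m (p + j) = nth 0 s j.

(** Row-major address in the [n * n] table based at [E]. *)
Definition key n E (e : nat * nat) := n * e.1 + e.2 + E.

Definition bounded n (e : nat * nat) := (e.1 < n) && (e.2 < n).

Lemma key_inj n E : {in bounded n &, injective (key n E)}.
Proof.
move=> [a b] [c d] /andP[/= _ ltb] /andP[/= _ ltd] /addIn /= Ekey.
have n_gt0 : 0 < n by lia.
have ac : a = c.
  have := congr1 (divn^~ n) Ekey.
  by rewrite !(mulnC n) !divnMDl // !divn_small // !addn0.
by move: Ekey; rewrite ac => /addnI->.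
Qed.

(** [K] lists the kept edges and [L] those still to be read, from cell [i] up to [E]. The table is
    constrained only at the keys of kept edges, where it holds their indices. *)
Record dedup_inv n E K i L m := DedupInv {
  inv0 : m 0 = n;
  inv_kept : stored m 2 (flat K);
  inv_table : forall j, j < size K -> m (key n E (nth (0, 0) K j)) = j;
  inv_todo : stored m i (flat L);
  inv_bounded : all (bounded n) K;
  inv_todo_size : i + (size L).*2 = E }.

Lemma nth_flat es j : j < size es ->
  nth 0 (flat es) j.*2 = (nth (0, 0) es j).1 /\
  nth 0 (flat es) j.*2.+1 = (nth (0, 0) es j).2.
Proof. by elim: es j => //= e es IH [|j] //= /IH. Qed.

(** The new edge is written below [i], hence over cells already read, and the table lies beyond [E],
    so the three writes spare the header, [K] and [L]. *)
Lemma inv_insert n E K i L m e : dedup_inv n E K i L m -> bounded n e ->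
  e \notin K -> (size K).*2 + 4 <= i ->
  dedup_inv n E (rcons K e) i L
    [eta [eta [eta m with key n E e |-> size K] with (size K).*2 + 2 |-> e.1]
      with (size K).*2 + 3 |-> e.2].
Proof.
move=> [m0 mK mt mL bK szL] be enK lei.
have leE e' : E <= key n E e' by rewrite leq_addl.
set m' := (X in dedup_inv _ _ _ _ _ X).
have out x : x != (size K).*2 + 3 -> x != (size K).*2 + 2 -> x != key n E e ->
    m' x = m x.
  by rewrite /m' /= => /negPf-> /negPf-> /negPf->.
split=> //.
- by rewrite out //; have := leE e; lia.
- move=> j; rewrite -cats1 flat_cat size_cat nth_cat size_flat /= => ltj.
  case: ltnP => [lt_jK|le_Kj].
    by rewrite out ?mK ?size_flat //; have := leE e; lia.
  have [->|->] : j = (size K).*2 \/ j = (size K).*2.+1 by lia.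
    by rewrite subnn /= addnC /m' /= eqxx; case: eqP => //; lia.
  by rewrite subSnn /= addnS addnC /m' /= -addnS eqxx.
- move=> j; rewrite size_rcons ltnS nth_rcons leq_eqVlt => /predU1P[->|lt_jK].
    rewrite ltnn eqxx /m' /= eqxx.
    by have := leE e; case: eqP; [lia|]; case: eqP; [lia|].
  rewrite lt_jK out ?mt //; try by have := leE (nth (0, 0) K j); lia.
  (* Overwriting the entry of a kept edge would, by injectivity of [key], mean that [e] was already
     kept. *)
  apply: contra enK => /eqP Ekey.
  rewrite -(key_inj _ _ Ekey) ?mem_nth //.
  by apply: (allP bK); rewrite mem_nth.
- move=> j; rewrite size_flat => ltj.
  by rewrite out ?mL ?size_flat //; have := leE e; lia.
- by rewrite all_rcons bK andbT.
Qed.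

Definition insert (K : seq (nat * nat)) e := if e \in K then K else rcons K e.

(* The table at address [E] is never initialised: an entry is trusted only
   after it has been checked against the list of kept edges. *)
Lemma inv_lookup n E K i L m e c : dedup_inv n E K i L m -> bounded n e ->
  c = m (key n E e) ->
  (e \in K) = [&& c < size K, m (c + c + 2) == e.1 & m (c + c + 2 + 1) == e.2].
Proof.
move=> [m0 mK mt mL bK szL] be Ec.
have mKE j : j < size K ->
    m (j + j + 2) = (nth (0, 0) K j).1 /\ m (j + j + 2 + 1) = (nth (0, 0) K j).2.
  move=> ltj; have [<- <-] := nth_flat ltj.
  rewrite -!mK ?size_flat; try lia.
  by split; congr m; lia.
apply/idP/and3P => [/(nthP (0, 0))[j ltj Ej]|[ltc]].
  by rewrite Ec -Ej mt //; have [-> ->] := mKE _ ltj.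
have [-> ->] := mKE _ ltc => /eqP E1 /eqP E2.
by rewrite [e]surjective_pairing -E1 -E2 -surjective_pairing mem_nth.
Qed.

(** Continuation style: [next] describes the run from the loop head on, for any scratch
    registers. *)
Lemma project_program_insert w n E K i L m e x7 x8 x9 x10 r T Q :
  dedup_inv n E K i L m -> bounded n e -> (size K).*2 + 4 <= i ->
  e \notin K -> x7 = key n E e -> E < 2 ^ w ->
  (forall x7 x8 x9 x10 m', dedup_inv n E (rcons K e) i L m' ->
     exec_le w project_program
       (State 11
          (regs [:: i; (size K).+1; E; e.1; e.2; 1; n; x7; x8; x9; x10; 2; 0] r)
          m')
       T Q) ->
  exec_le w project_program
    (State 36 (regs [:: i; size K; E; e.1; e.2; 1; n; x7; x8; x9; x10; 2; 0] r) m)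
    (8 + T) Q.
Proof.
move=> I be lei enK Ex7 ltE next.
have := inv_todo_size I => EE.
run; rewrite /=. add. add. run; rewrite /=. add. run; rewrite /=. add. run.
have -> : size K + size K + 2 = (size K).*2 + 2 by lia.
have -> : (size K).*2 + 2 + 1 = (size K).*2 + 3 by lia.
by rewrite addn1 Ex7; apply/next/inv_insert.
Qed.

Lemma project_program_lookup w n E K i L m e x7 x8 x9 x10 r T Q :
  dedup_inv n E K i L m -> bounded n e -> (size K).*2 + 4 <= i ->
  E + n * n < 2 ^ w ->
  (forall K' x7 x8 x9 x10 m', K' = insert K e -> dedup_inv n E K' i L m' ->
     exec_le w project_program
       (State 11
          (regs [:: i; size K'; E; e.1; e.2; 1; n; x7; x8; x9; x10; 2; 0] r) m')
       T Q) ->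
  exec_le w project_program
    (State 22 (regs [:: i; size K; E; e.1; e.2; 1; n; x7; x8; x9; x10; 2; 0] r) m)
    (20 + T) Q.
Proof.
move=> I be lei ltw next.
have EE := inv_todo_size I.
have lt_key : key n E e < 2 ^ w.
  apply: leq_ltn_trans ltw; rewrite /key addnC leq_add2l.
  have /andP[lt1 lt2] := be; nia.
(* The three ways of failing the lookup, by index or by either end, all reach the insertion code
   with different scratch registers. *)
have new x7' x8' x9' x10' : e \notin K -> x7' = key n E e ->
    exec_le w project_program
      (State 36 (regs [:: i; size K; E; e.1; e.2; 1; n; x7'; x8'; x9'; x10'; 2; 0] r) m)
      (8 + T) Q.
  move=> enK Ex7; apply: project_program_insert => //; [exact: I | lia |].
  move=> y7 y8 y9 y10 m' I'; rewrite -(size_rcons K e).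
  by apply: next I'; rewrite /insert (negPf enK).
(* The full lookup takes 12 instructions, the insertion 8. *)
rewrite -[20 + T]/(12 + (8 + T)).
have ltn2 : e.2 < n by case/andP: be.
have Em := inv_lookup I be (erefl _).
rewrite /key in lt_key.
run; [by apply: eval_mul; rewrite /=; lia|]; rewrite /=.
add; add.
run; [by []|]; rewrite /=.
rewrite -/(key n E e) in Em *; move: (m (key n E e)) Em => c Em.
case ltc: (c < size K) Em => /= Em; last first.
  branch false => //.
  apply: (@exec_le_weaken _ _ _ (1 + (8 + T))); first by lia.
  by run; apply: new; rewrite ?Em.
branch true => //.
add; add.
run; [by []|]; rewrite /=.
case E1: (m _ == _) Em => /= Em; last first.
  branch false => //.
  apply: (@exec_le_weaken _ _ _ (1 + (8 + T))); first by lia.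
  by run; apply: new; rewrite ?Em.
branch true => //.
add.
run; [by []|]; rewrite /=.
branch (e \in K) => //.
case: (boolP (e \in K)) => eK; last by apply: new.
apply: (@exec_le_weaken _ _ _ T); first by lia.
by apply: next; rewrite // /insert eK.
Qed.

Definition proj_pair (e : nat * nat) :=
  if e.1./2 < e.2./2 then (e.1./2, e.2./2) else (e.2./2, e.1./2).

(** An iteration takes at most 11 instructions to read, halve and sort an edge and 20 to look it up
    and insert it; leaving the loop takes 3. The bound on [i] keeps the writing position behind the
    reading one. *)
Lemma project_program_loop w n E K i L m x3 x4 x7 x8 x9 x10 r :
  dedup_inv n E K i L m -> (size K).*2 + 2 <= i ->
  all (fun e => (e.1 < n.*2) && (e.2 < n.*2)) L ->
  E + n * n < 2 ^ w -> n.*2 < 2 ^ w ->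
  let K' := foldl insert K (map proj_pair L) in
  exec_le w project_program
    (State 11 (regs [:: i; size K; E; x3; x4; 1; n; x7; x8; x9; x10; 2; 0] r) m)
    (31 * size L + 3)
    (fun s => stored (Defs.mem s) 0 [:: n, size K' & flat K']).
Proof.
move=> + + + ltw ltn.
elim: L K i m x3 x4 x7 x8 x9 x10 => [|[x y] L IH] K i m x3 x4 x7 x8 x9 x10 I lei.
  move=> _ K'; have EE := inv_todo_size I.
  branch true; first by rewrite -EE addn0 eqxx.
  run; apply: exec_le_halt => // -[|[|j]] ltj.
  - exact: (inv0 I).
  - by [].
  - exact: (inv_kept I).
move=> /= /andP[/andP[ltx lty] ltL]; have EE := inv_todo_size I.
rewrite mulnS -[31 + _ + 3]addnA.
move: (31 * size L + 3) {IH}(IH (insert K (proj_pair (x, y))) i.+2) => T IH.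
move: EE => /= EE.
have I' : dedup_inv n E K i.+2 L m.
  case: I => m0 mK mt mL bK szL; split=> //; last by move: szL => /=; lia.
  by move=> j ltj; have := mL j.+2; rewrite !addnS !addSn; apply.
have mi : m i = x by have := inv_todo I (j := 0) isT; rewrite addn0.
have mi1 : m (i + 1) = y by apply: (inv_todo I (j := 1)).
have W : 2 < 2 ^ w by lia.
branch false; first by lia.
run; [exact: mi|]; rewrite /=.
run; [by apply: eval_half; rewrite /=; lia|]; rewrite /=.
add.
run; [exact: mi1|]; rewrite /=.
run; [by apply: eval_half; rewrite /=; lia|]; rewrite /=.
add.
have -> : i + 1 + 1 = i.+2 by lia.
set e := proj_pair (x, y) in IH *.
have be : bounded n e by rewrite /e /proj_pair /bounded; case: ifP => /= _; lia.
(* Both orders of the ends meet here; swapping them only changes scratch register 10. *)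
have next y10 : exec_le w project_program
    (State 22 (regs [:: i.+2; size K; E; e.1; e.2; 1; n; x7; x8; x9; y10; 2; 0] r) m)
    (20 + T) (fun s => let K' := foldl insert (insert K e) (map proj_pair L) in
                       stored (Defs.mem s) 0 [:: n, size K' & flat K']).
  apply: project_program_lookup => //; [exact: I' | lia | ].
  move=> _ y7 y8 y9 z10 m' -> I''; apply: IH => //.
  by rewrite /insert; case: ifP; rewrite ?size_rcons; lia.
branch (x./2 < y./2) => //; move: (next); rewrite /e /proj_pair /=.
case: ifP => _ next'; first by apply: exec_le_weaken (next' _); lia.
add; add; add; rewrite !addn0.
by apply: exec_le_weaken (next' _); lia.
Qed.

(** Induction from the right: a last element of [L] is the head of [rev L], where [undup] tests it
    against the rest. *)
Lemma foldl_insert L : foldl insert [::] L = rev (undup (rev L)).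
Proof.
elim/last_ind: L => // L e IH.
rewrite foldl_rcons IH rev_rcons /= /insert mem_rev mem_undup.
by case: ifP; rewrite ?rev_cons.
Qed.

Lemma project_program_exec w n L r m :
  all (fun e => (e.1 < n.*2) && (e.2 < n.*2)) L ->
  stored m 0 [:: n.*2, size L & flat L] ->
  2 + (size L).*2 + n * n < 2 ^ w -> n.*2 < 2 ^ w ->
  let K := rev (undup (rev (map proj_pair L))) in
  exec_le w project_program (State 0 r m) (31 * size L + 14)
    (fun s => stored (Defs.mem s) 0 [:: n, size K & flat K]).
Proof.
move=> ltL mL ltw ltn; rewrite -foldl_insert => K.
have W : 2 < 2 ^ w by lia.
rewrite (_ : 31 * size L + 14 = 11 + (31 * size L + 3)); last by lia.
have := @project_program_loop w n (2 + (size L).*2) [::] 2 L [eta m with 0 |-> n].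
move: (31 * size L + 3) => T loop.
(* The given algorithm leaves arbitrary registers; the thirteen in use are exposed. *)
have -> : r = regs [:: r 0; r 1; r 2; r 3; r 4; r 5; r 6; r 7; r 8; r 9; r 10;
                       r 11; r 12] r.
  apply/funext => i; rewrite /regs.
  by do 13![case: i => [|i] //]; rewrite nth_default.
run; first by lia.
run; first by lia.
run; first by lia.
run; [exact: (mL 0)|]; rewrite /=.
run; [by apply: eval_half|]; rewrite /= doubleK.
run; rewrite /=.
run; [exact: (mL 1)|]; rewrite /=.
add; add.
run; first by lia.
run; first by lia.
rewrite addnn [_ + 2]addnC /=; apply: loop => //.
split=> //=.
by move=> j ltj; apply: (mL j.+2).
Qed.

(** * Machine encodings of the edge lists *)

Definition vals n (es : seq ('I_n * 'I_n)) : seq (nat * nat) :=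
  [seq (val e.1, val e.2) | e <- es].

Lemma encodeE n (es : seq ('I_n * 'I_n)) :
  encode es = [:: n, size es & flat (vals es)].
Proof. by rewrite /encode /flat -map_comp. Qed.

Lemma size_vals n (es : seq ('I_n * 'I_n)) : size (vals es) = size es.
Proof. exact: size_map. Qed.

Lemma vals_bounded n (es : seq ('I_n * 'I_n)) :
  all (fun e => (e.1 < n) && (e.2 < n)) (vals es).
Proof. by apply/allP => _ /mapP[[u v] _ ->] /=; rewrite !ltn_ord. Qed.

Lemma encode_cover n (es : seq ('I_n * 'I_n)) :
  encode (cover_edges es) =
    [:: n.*2, (size es).*2 & flat (lowers (vals es) ++ uppers (vals es))].
Proof.
have -> : lowers (vals es) ++ uppers (vals es) = vals (cover_edges es).
  by rewrite /lowers /uppers /vals map_cat -!map_comp.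
by rewrite encodeE -mul2n size_cat !size_map addnn.
Qed.

Lemma vals_proj_edges n (hs : seq ('I_(2 * n) * 'I_(2 * n))) :
  vals (proj_edges hs) = rev (undup (rev (map proj_pair (vals hs)))).
Proof.
have inj : injective (fun e : 'I_n * 'I_n => (val e.1, val e.2)).
  by move=> [a b] [c d] /= [/val_inj-> /val_inj->].
rewrite /vals /proj_edges map_rev -undup_map_inj // map_rev -!map_comp.
congr (rev (undup (rev _))); apply: eq_map => -[x y] /=.
by rewrite /proj_edge /proj_pair /=; case: ifP.
Qed.

(** * Word length, running time, and the conclusion *)

Lemma exec_gt0 w P s t s' : exec w P s t s' -> 0 < t.
Proof. by case. Qed.

Lemma word_bound n m c : 4 * m + n * n + 2 * n + 6 < (n + m + 2) ^ (2 * c + 4).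
Proof.
apply: (@leq_trans ((n + m + 2) ^ 4)); last by rewrite leq_pexp2l //; lia.
by rewrite !expnS; nia.
Qed.

Lemma cover_bound n m c : (2 * n + 2 * m + 2) ^ c <= (n + m + 2) ^ (2 * c + 4).
Proof.
apply: (@leq_trans ((n + m + 2) ^ (2 * c))); last by rewrite leq_pexp2l //; lia.
by rewrite expnM; case: c => // c; rewrite leq_exp2r // !expnS; nia.
Qed.

Local Open Scope ring_scope.

Theorem theorem5 (R : realType) (k : nat) (f g : nat -> nat -> R) :
  spanner_algorithm (2 * k + 1) f g ->
  spanner_algorithm (2 * k)
    (fun n m : nat => f (2 * n)%N (2 * m)%N)
    (fun n m : nat => g (2 * n)%N (2 * m)%N + m%:R).
Proof.
move=> [P [c [Cf [Cg [Cf_gt0 Cg_gt0 algP]]]]].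
(* [2 * c] serves [P] on the cover, as [2 * n + 2 * m + 2] is at most [(n + m + 2) ^ 2]; the 4 makes
   room for the table and the doubled lists. *)
exists (seqprog cover_program (seqprog P project_program)), (2 * c + 4)%N.
exists Cf, (33 * Cg + 78).
split=> [//||n G es w m Ges le_w]; first by lra.
have Ges' := cover_edge_list Ges.
have Em : m = size es := size_edge_list Ges.
have Em' : #|edges (double_cover G)| = (2 * m)%N.
  by rewrite (size_edge_list Ges') size_cat !size_map addnn mul2n Em.
have ltw := leq_trans (word_bound n m c) le_w.
have [|t [s [H [hs [exP [out Hhs] spH leH let_]]]]] := algP _ _ _ w Ges'.
  by rewrite Em'; apply: leq_trans le_w; apply: cover_bound.
rewrite Em' in leH let_.
have sHG : subrel (adj H) (adj (double_cover G)) by case: spH => /edges_subP.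
(* Being a subgraph of the cover, [H] can be read in time linear in [m]. *)
have le_hs : (size hs <= 2 * m)%N.
  rewrite -Em' -(size_edge_list Hhs); apply: subset_leq_card.
  by case: spH.
have lt2n : (n.*2 < 2 ^ w)%N by lia.
have [|t1 [s1 [le1 ex1 Es1]]] := cover_program_exec (vals_bounded es) lt2n.
  by rewrite size_vals -Em; lia.
subst s1; rewrite size_vals -encode_cover -encodeE in ex1.
have [|||t3 [s3 [le3 ex3 out3]]] :=
  @project_program_exec w n (vals hs) (reg s) (Defs.mem s) _ _ _ lt2n.
- by rewrite -mul2n; apply: vals_bounded.
- by rewrite -mul2n size_vals -encodeE.
- by rewrite size_vals; lia.
rewrite -vals_proj_edges size_vals -encodeE in out3.
have ex := exec_seqprog ex1 (exec_seqprog exP ex3).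
have Hhs' := proj_edge_list sHG Hhs.
do 4!eexists; split; [exact: ex | | exact: proj_spanner spH | |].
- by split; [exact: out3 | exact: Hhs'].
- apply: le_trans leH; rewrite ler_nat (size_edge_list Hhs').
  by rewrite (size_edge_list Hhs) size_proj_edges.
have t_gt0 := exec_gt0 exP.
(* The sum is at most [(16 * m + 18) + t + (31 * (2 * m) + 14)]; the constant 32 is absorbed by
   [32 * t], as [t] is positive. *)
have le_t : (t1 + (t + t3))%:R <= 33 * t%:R + 78 * m%:R :> R.
  by rewrite -!natrM -natrD ler_nat; rewrite !size_vals in le1 le3; lia.
apply: (le_trans le_t).
have t_ge1 : 1 <= t%:R :> R by rewrite ler1n.
(* Positivity of [g] and of [Cg * m] disposes of the cross terms of [(33 * Cg + 78) * (g + m)]. *)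
have g_gt0 : 0 < g (2 * n)%N (2 * m)%N.
  by rewrite -(pmulr_rgt0 _ Cg_gt0); lra.
have m_ge0 : 0 <= m%:R :> R by [].
have Cgm_ge0 : 0 <= Cg * m%:R by rewrite mulr_ge0 // ltW.
by rewrite mulrDr !mulrDl -mulrA -[_ * _ * m%:R]mulrA; lra.
Qed.
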